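(* The following predicates on natural numbers (codes) are primitive recursive: (1) the pair-decoding predicate $\operatorname{Pair}(c,a,b)$; (2) the axiom-head predicate ''$\varphi$ is the code of an instance of $\mathbf{K}$ or of $\mathbf{S}$''; (3) the predicate ''the $j$-th line of the finite derivation code $D$ is accepted by Modus Ponens alignment''; (4) the bounded witness predicate $W(\varphi,D)$.
   Context: Carryless pairing: for $a,b\in\mathbb{N}$ with binary expansions $a=\sum_{i}\alpha_i2^i$, $b=\sum_i\beta_i2^i$ ($\alpha_i,\beta_i\in\{0,1\}$), let $\pi_{\mathrm{CL}}(a,b)=\sum_i\alpha_i2^{2i}+\sum_i\beta_i2^{2i+1}$. For $c\in\mathbb{N}$ with binary expansion $c=\sum_i\gamma_i2^i$, let $\operatorname{even}(c)=\sum_i\gamma_{2i}2^i$ and $\operatorname{odd}(c)=\sum_i\gamma_{2i+1}2^i$. The predicate $\operatorname{Pair}(c,a,b)$ holds iff $\operatorname{even}(c)=a$ and $\operatorname{odd}(c)=b$ (equivalently, $c=\pi_{\mathrm{CL}}(a,b)$). Formulas: fix a formula language with a binary connective $\to$ (implicational Hilbert fragment) and a primitive recursive Gödel coding of its formulas by natural numbers: the set of formula codes, the map sending codes of $A,B$ to the code of $A\to B$, the test whether a code is that of an implication, and the extraction of the codes of its antecedent and consequent are primitive recursive. Finite sequences of natural numbers are coded by a standard primitive recursive coding. Axiom heads: $\mathbf{K}$ is the schema $A\to(B\to A)$ and $\mathbf{S}$ is the schema $(A\to(B\to C))\to((A\to B)\to(A\to C))$. A formula code $\varphi$ passes the axiom-head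 check (and a line with formula code $\varphi$ is then accepted as an axiom instance) iff $\varphi$ matches one of these schemata under a uniform substitution of formula codes for the schematic letters $A,B,C$. Lines: a proof line is a code $\ell=\pi_{\mathrm{CL}}(t,\varphi)$, where $t$ is a tag and $\varphi$ is a formula code (the formula code of the line). The tag says whether the line is to be checked as an axiom instance or by Modus Ponens (MP); an MP tag also contains two cited indices $p,q$. Tags are coded by natural numbers so that recognizing an MP tag and extracting $p,q$ from it are primitive recursive. A derivation code is (the code of) a finite sequence $D=(\ell_0,\ldots,\ell_{r-1})$ of line codes. MP alignment: line $\ell_j$ of $D$ is accepted by MP alignment iff its tag is an MP tag naming indices $p,q<j$, the formula code on $\ell_q$ is the code of an implication $A\to B$, the formula code on $\ell_p$ equals the code of $A$, and the formula code on $\ell_j$ equals the code of $B$. Bounded witness: $W(\varphi,D)$ holds iff $D=(\ell_0,\ldots,\ell_{r-1})$ is a derivation code with a last line, the last line has formula code $\varphi$, and every line of $D$ is accepted either by the axiom-head check or by MP alignment using the earlier lines named in its tag. *)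

(* Defs.v *)
(* MathComp *)
From mathcomp Require Import all_boot.

Set Implicit Arguments.
Unset Strict Implicit.
Unset Printing Implicit Defensive.

(* primrec n f: the n-ary function f is primitive recursive.  The recursion
   variable is the first argument; the step function receives the predecessor,
   the previous value and the parameters, in this order. *)
Inductive primrec : forall n : nat, (n.-tuple nat -> nat) -> Prop :=
| primrec_zero : @primrec 0 (fun=> 0)
| primrec_succ : @primrec 1 (fun v => (thead v).+1)
| primrec_proj n (i : 'I_n) : primrec (fun v : n.-tuple nat => tnth v i)
| primrec_comp m n (f : m.-tuple nat -> nat)
    (g : 'I_m -> n.-tuple nat -> nat) :
    primrec f -> (forall i, primrec (g i)) ->
    primrec (fun v : n.-tuple nat => f [tuple g i v | i < m])
| primrec_rec n (f : n.-tuple nat -> nat) (g : n.+2.-tuple nat -> nat) :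
    primrec f -> primrec g ->
    primrec (fun v : n.+1.-tuple nat =>
      nat_rect (fun=> nat) (f [tuple of behead v])
        (fun k r => g [tuple of k :: r :: behead v]) (thead v))
| primrec_ext n (f g : n.-tuple nat -> nat) :
    f =1 g -> primrec f -> primrec g.

(* A predicate is primitive recursive when its characteristic function is. *)
Definition primrec_pred n (P : n.-tuple nat -> Prop) : Prop :=
  exists2 b : pred (n.-tuple nat),
    primrec (fun v => nat_of_bool (b v)) & forall v, P v <-> b v.

Definition primrec_fun1 (f : nat -> nat) : Prop :=
  primrec (fun v : 1.-tuple nat => f (nth 0 v 0)).
Definition primrec_fun2 (f : nat -> nat -> nat) : Prop :=
  primrec (fun v : 2.-tuple nat => f (nth 0 v 0) (nth 0 v 1)).
Definition primrec_pred1 (P : nat -> Prop) : Prop :=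
  primrec_pred (fun v : 1.-tuple nat => P (nth 0 v 0)).
Definition primrec_pred2 (P : nat -> nat -> Prop) : Prop :=
  primrec_pred (fun v : 2.-tuple nat => P (nth 0 v 0) (nth 0 v 1)).
Definition primrec_pred3 (P : nat -> nat -> nat -> Prop) : Prop :=
  primrec_pred (fun v : 3.-tuple nat => P (nth 0 v 0) (nth 0 v 1) (nth 0 v 2)).

Definition bit (a i : nat) : bool := odd (a %/ 2 ^ i).

(* In the next three definitions the bound on i loses nothing: a < 2 ^ a, so
   bit a i = false for i >= a. *)
Definition pair_CL (a b : nat) : nat :=
  \sum_(i < a) bit a i * 2 ^ (2 * i) + \sum_(i < b) bit b i * 2 ^ (2 * i + 1).
Definition even_CL (c : nat) : nat := \sum_(i < c) bit c (2 * i) * 2 ^ i.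
Definition odd_CL (c : nat) : nat := \sum_(i < c) bit c (2 * i + 1) * 2 ^ i.

Definition Pair (c a b : nat) : Prop := even_CL c = a /\ odd_CL c = b.

(* The maps on codes in these records are total on nat; only their values on
   actual codes are constrained. *)
Record formula_coding := FormulaCoding {
  formula : Type;
  imp : formula -> formula -> formula;
  fcode : formula -> nat;
  fcode_inj : injective fcode;
  fcode_primrec : primrec_pred1 (fun n => exists A, n = fcode A);
  imp_primrec : exists2 f : nat -> nat -> nat, primrec_fun2 f &
    forall A B, f (fcode A) (fcode B) = fcode (imp A B);
  is_imp_primrec : primrec_pred1 (fun n => exists A B, n = fcode (imp A B));
  antecedent_primrec : exists2 f : nat -> nat, primrec_fun1 f &
    forall A B, f (fcode (imp A B)) = fcode A;
  consequent_primrec : exists2 f : nat -> nat, primrec_fun1 f &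
    forall A B, f (fcode (imp A B)) = fcode B }.

Record seq_coding := SeqCoding {
  scode : seq nat -> nat;
  scode_inj : injective scode;
  scode_primrec : primrec_pred1 (fun n => exists s, n = scode s);
  size_primrec : exists2 f : nat -> nat, primrec_fun1 f &
    forall s, f (scode s) = size s;
  nth_primrec : exists2 f : nat -> nat -> nat, primrec_fun2 f &
    forall s i, i < size s -> f (scode s) i = nth 0 s i }.

(* A tag that is not an MP tag is an axiom tag; it may carry any further
   information.  Taking is_tag to be everywhere true is allowed. *)
Record tag_coding := TagCoding {
  is_tag : nat -> Prop;
  is_MP_tag : nat -> Prop;
  cited_p : nat -> nat;
  cited_q : nat -> nat;
  MP_tag_tag : forall t, is_MP_tag t -> is_tag t;
  is_tag_primrec : primrec_pred1 is_tag;
  is_MP_tag_primrec : primrec_pred1 is_MP_tag;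
  cited_p_primrec : primrec_fun1 cited_p;
  cited_q_primrec : primrec_fun1 cited_q }.

Definition schema_K (F : formula_coding) (A B : formula F) : formula F :=
  imp A (imp B A).
Definition schema_S (F : formula_coding) (A B C : formula F) : formula F :=
  imp (imp A (imp B C)) (imp (imp A B) (imp A C)).

Definition axiom_head (F : formula_coding) (phi : nat) : Prop :=
  (exists A B : formula F, phi = fcode (schema_K A B)) \/
  (exists A B C : formula F, phi = fcode (schema_S A B C)).

Definition line_code (F : formula_coding) (T : tag_coding) (l : nat) : Prop :=
  exists (t : nat) (A : formula F), is_tag T t /\ l = pair_CL t (fcode A).
Definition line_tag (l : nat) : nat := even_CL l.
Definition line_formula (l : nat) : nat := odd_CL l.

Definition derivation (F : formula_coding) (T : tag_coding) (s : seq nat) :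
  Prop := forall l, l \in s -> line_code F T l.

Definition MP_aligned (F : formula_coding) (T : tag_coding) (s : seq nat)
    (j : nat) : Prop :=
  let t := line_tag (nth 0 s j) in
  let p := cited_p T t in
  let q := cited_q T t in
  [/\ is_MP_tag T t, p < j, q < j &
      exists A B : formula F,
        [/\ line_formula (nth 0 s q) = fcode (imp A B),
            line_formula (nth 0 s p) = fcode A &
            line_formula (nth 0 s j) = fcode B]].

Definition MP_accepted (F : formula_coding) (S : seq_coding) (T : tag_coding)
    (j D : nat) : Prop :=
  exists s : seq nat,
    [/\ D = scode S s, derivation F T s, j < size s & MP_aligned F T s j].

(* Acceptance by the axiom-head check depends on the formula code of the line
   only, not on its tag. *)
Definition witness (F : formula_coding) (S : seq_coding) (T : tag_coding)
    (phi D : nat) : Prop :=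
  exists s : seq nat,
    [/\ D = scode S s, derivation F T s, 0 < size s,
        line_formula (last 0 s) = phi &
        forall j, j < size s ->
          axiom_head F (line_formula (nth 0 s j)) \/ MP_aligned F T s j].

(* Main.v *)
(* Every quantifier can be bounded or eliminated, and bounded quantifiers
   reduce to bounded sums.  In [line_code], the tag and the formula code of a
   line are bounded by the line because interleaving bits only moves them up; in
   [MP_aligned] and [axiom_head], the schematic letters are read off by iterated
   extraction of antecedents and consequents, injectivity of [fcode] making
   this decoding faithful. *)
Require Import Defs.
From mathcomp Require Import all_boot zify.

Set Implicit Arguments.
Unset Strict Implicit.
Unset Printing Implicit Defensive.

(** * Substitution, recursion and elementary arithmetic *)

(** Composition with the family of functions given as one tuple-valued map: explicit tuples can be
    substituted, and their components checked by cases on a natural index. *)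
Lemma primrec_subst m n (f : m.-tuple nat -> nat)
    (t : n.-tuple nat -> m.-tuple nat) :
  primrec f -> (forall i, i < m -> primrec (fun v => nth 0 (t v) i)) ->
  primrec (fun v => f (t v)).
Proof.
move=> f_pr t_pr.
apply: primrec_ext (primrec_comp f_pr (fun i => t_pr _ (ltn_ord i))) => v.
by congr f; apply: eq_from_tnth => i; rewrite tnth_mktuple -tnth_nth.
Qed.

Lemma primrec_comp1 n (f : nat -> nat) (a : n.-tuple nat -> nat) :
  primrec_fun1 f -> primrec a -> primrec (fun v => f (a v)).
Proof.
move=> f_pr a_pr.
by apply: (@primrec_subst 1 n _ (fun v => [tuple a v])) f_pr _; case.
Qed.

Lemma primrec_comp2 n (f : nat -> nat -> nat) (a b : n.-tuple nat -> nat) :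
  primrec_fun2 f -> primrec a -> primrec b -> primrec (fun v => f (a v) (b v)).
Proof.
move=> f_pr a_pr b_pr.
by apply: (@primrec_subst 2 n _ (fun v => [tuple a v; b v])) f_pr _;
  case=> [|[]].
Qed.

Lemma succn_primrec : primrec_fun1 succn.
Proof.
by apply: primrec_ext primrec_succ => v; rewrite /thead (tnth_nth 0).
Qed.

Lemma primrec_const n c : primrec (fun _ : n.-tuple nat => c).
Proof.
elim: c => [|c IHc];
  first exact: (@primrec_subst 0 n _ (fun=> [tuple])) primrec_zero _.
exact: primrec_comp1 succn_primrec IHc.
Qed.

(** No bound on [i] is required: out of range, the default 0 makes this a constant function. *)
Lemma primrec_nth n i : primrec (fun v : n.-tuple nat => nth 0 v i).
Proof.
have [lt_in | le_ni] := ltnP i n.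
  by apply: primrec_ext (primrec_proj (Ordinal lt_in))
    => v; rewrite (tnth_nth 0).
by apply: primrec_ext (primrec_const n 0) => v; rewrite nth_default ?size_tuple.
Qed.

(** Sums and quantifiers put their bound variable at the head of the argument tuple, so the
    parameters are read behind it. *)
Lemma primrec_nth_behead n i :
  primrec (fun v : n.-tuple nat => nth 0 (behead v) i).
Proof. by apply: primrec_ext (primrec_nth n i.+1) => v; rewrite nth_behead. Qed.

Lemma primrec_nth_behead2 n i :
  primrec (fun v : n.-tuple nat => nth 0 (behead (behead v)) i).
Proof.
by apply: primrec_ext (primrec_nth n i.+2) => v; rewrite !nth_behead.
Qed.

Lemma eq_nat_rect x y (g h : nat -> nat -> nat) m :
  x = y -> g =2 h ->
  nat_rect (fun=> nat) x g m = nat_rect (fun=> nat) y h m.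
Proof. by move=> -> eq_gh; elim: m => //= m ->. Qed.

(** Recursion up to a computed bound: apply [primrec_rec] to [b v :: v], whose tail gives back all
    the parameters, including those on which the bound depends. *)
Lemma primrec_nat_rect n (f b : n.-tuple nat -> nat)
    (g : nat -> nat -> n.-tuple nat -> nat) :
  primrec f -> primrec b ->
  primrec (fun w : n.+2.-tuple nat =>
    g (nth 0 w 0) (nth 0 w 1) [tuple of behead (behead w)]) ->
  primrec (fun v => nat_rect (fun=> nat) (f v) (fun k r => g k r v) (b v)).
Proof.
move=> f_pr b_pr g_pr.
apply: primrec_ext
  (@primrec_subst _ _ _ (fun v => [tuple of b v :: v])
    (primrec_rec f_pr g_pr) _).
  move=> v; rewrite theadE.
  by apply: eq_nat_rect => [|k r]; [congr f | congr g]; apply: val_inj.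
by case=> [|i] _ //; apply: primrec_nth.
Qed.

Lemma addn_primrec : primrec_fun2 addn.
Proof.
apply: primrec_ext (@primrec_nat_rect 2 _ _ (fun _ r _ => r.+1)
  (primrec_nth _ 1) (primrec_nth _ 0) _).
  by move=> v; elim: (nth 0 v 0) => //= k ->.
exact: primrec_comp1 succn_primrec (primrec_nth _ 1).
Qed.

Lemma muln_primrec : primrec_fun2 muln.
Proof.
apply: primrec_ext (@primrec_nat_rect 2 _ _ (fun _ r v => nth 0 v 1 + r)
  (primrec_const _ 0) (primrec_nth _ 0) _).
  by move=> v; elim: (nth 0 v 0) => //= k ->.
exact: primrec_comp2 addn_primrec (primrec_nth_behead2 _ _) (primrec_nth _ _).
Qed.

Lemma expn_primrec : primrec_fun2 expn.
Proof.
apply: primrec_ext (@primrec_nat_rect 2 _ _ (fun _ r v => nth 0 v 0 * r)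
  (primrec_const _ 1) (primrec_nth _ 1) _).
  by move=> v; elim: (nth 0 v 1) => //= k ->; rewrite expnS.
exact: primrec_comp2 muln_primrec (primrec_nth_behead2 _ _) (primrec_nth _ _).
Qed.

Lemma predn_primrec : primrec_fun1 predn.
Proof.
apply: primrec_ext (@primrec_nat_rect 1 _ _ (fun k _ _ => k)
  (primrec_const _ 0) (primrec_nth _ 0) (primrec_nth _ 0)).
by move=> v; case: (nth 0 v 0).
Qed.

Lemma subn_primrec : primrec_fun2 subn.
Proof.
apply: primrec_ext (@primrec_nat_rect 2 _ _ (fun _ r _ => r.-1)
  (primrec_nth _ 0) (primrec_nth _ 1) _).
  by move=> v; elim: (nth 0 v 1) => [|k /= ->]; rewrite ?subn0 ?subnS.
exact: primrec_comp1 predn_primrec (primrec_nth _ 1).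
Qed.

Lemma primrec_sum n (f : nat -> n.-tuple nat -> nat) (b : n.-tuple nat -> nat) :
  primrec b ->
  primrec (fun w : n.+1.-tuple nat => f (nth 0 w 0) [tuple of behead w]) ->
  primrec (fun v => \sum_(i < b v) f i v).
Proof.
move=> b_pr f_pr.
apply: primrec_ext (@primrec_nat_rect n _ _ (fun k r v => r + f k v)
  (primrec_const _ 0) b_pr _).
  by move=> v; elim: (b v) => [|k /= ->]; rewrite ?big_ord0 ?big_ord_recr.
apply: primrec_comp2 addn_primrec (primrec_nth _ 1) _.
(* The step function sees the counter, the partial sum and the parameters; the summand takes these
   arguments without the partial sum. *)
apply: primrec_ext (@primrec_subst _ _ _
  (fun w : n.+2.-tuple nat =>
     [tuple of nth 0 w 0 :: behead (behead w)]) f_pr _) => [w|].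
  by congr f; apply: val_inj.
by case=> [|i] _ /=; [apply: primrec_nth | apply: primrec_nth_behead2].
Qed.

(** * Closure properties of primitive recursive predicates *)

Lemma primrec_pred_ext n (P Q : n.-tuple nat -> Prop) :
  (forall v, P v <-> Q v) -> primrec_pred P -> primrec_pred Q.
Proof.
by move=> eqPQ [b b_pr Pb]; exists b => // v; rewrite -eqPQ.
Qed.

(** The characteristic function is the truncated difference [1 - f v]. *)
Lemma primrec_pred_eq0 n (f : n.-tuple nat -> nat) :
  primrec f -> primrec_pred (fun v => f v = 0).
Proof.
move=> f_pr; exists (fun v => f v == 0) => [|v]; last by split=> /eqP.
apply: primrec_ext (primrec_comp2 subn_primrec (primrec_const _ 1) f_pr).
by move=> v; case: (f v).
Qed.

Lemma primrec_pred_comp1 n (P : nat -> Prop) (f : n.-tuple nat -> nat) :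
  primrec_pred1 P -> primrec f -> primrec_pred (fun v => P (f v)).
Proof.
move=> [b b_pr Pb] f_pr; exists (fun v => b [tuple f v]) => [|v].
  by apply: (@primrec_subst 1 n _ (fun v => [tuple f v])) b_pr _; case.
by rewrite -Pb.
Qed.

Lemma primrec_pred_comp2 n (P : nat -> nat -> Prop)
    (f g : n.-tuple nat -> nat) :
  primrec_pred2 P -> primrec f -> primrec g ->
  primrec_pred (fun v => P (f v) (g v)).
Proof.
move=> [b b_pr Pb] f_pr g_pr; exists (fun v => b [tuple f v; g v]) => [|v].
  by apply: (@primrec_subst 2 n _ (fun v => [tuple f v; g v])) b_pr _;
    case=> [|[]].
by rewrite -Pb.
Qed.

Lemma primrec_pred_eq n (f g : n.-tuple nat -> nat) :
  primrec f -> primrec g -> primrec_pred (fun v => f v = g v).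
Proof.
move=> f_pr g_pr.
apply: (@primrec_pred_ext _ (fun v => (f v - g v) + (g v - f v) = 0)).
  by move=> v; lia.
by apply: primrec_pred_eq0; apply: primrec_comp2 addn_primrec _ _;
  apply: primrec_comp2 subn_primrec _ _.
Qed.

Lemma primrec_pred_lt n (f g : n.-tuple nat -> nat) :
  primrec f -> primrec g -> primrec_pred (fun v => f v < g v).
Proof.
move=> f_pr g_pr.
apply: (@primrec_pred_ext _ (fun v => (f v).+1 - g v = 0)).
  by move=> v; lia.
apply: primrec_pred_eq0; apply: primrec_comp2 subn_primrec _ g_pr.
exact: primrec_comp1 succn_primrec f_pr.
Qed.

Lemma primrec_predN n (P : n.-tuple nat -> Prop) :
  primrec_pred P -> primrec_pred (fun v => ~ P v).
Proof.
move=> [b b_pr Pb].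
apply: primrec_pred_ext (primrec_pred_eq0 b_pr) => v.
by rewrite Pb; case: (b v); split=> // /(_ isT).
Qed.

Lemma primrec_predI n (P Q : n.-tuple nat -> Prop) :
  primrec_pred P -> primrec_pred Q -> primrec_pred (fun v => P v /\ Q v).
Proof.
move=> [b b_pr Pb] [c c_pr Qc]; exists (fun v => b v && c v) => [|v].
  apply: primrec_ext (primrec_comp2 muln_primrec b_pr c_pr) => v.
  by rewrite mulnb.
by rewrite Pb Qc; split=> /andP.
Qed.

(** By De Morgan; the direction that is not constructive in general holds because booleans decide
    both predicates. *)
Lemma primrec_predU n (P Q : n.-tuple nat -> Prop) :
  primrec_pred P -> primrec_pred Q -> primrec_pred (fun v => P v \/ Q v).
Proof.
move=> P_pr Q_pr.
have := primrec_predN (primrec_predI (primrec_predN P_pr) (primrec_predN Q_pr)).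
case: P_pr Q_pr => [b _ Pb] [c _ Qc]; apply: primrec_pred_ext => v.
by rewrite Pb Qc; case: (b v) (c v) => -[]; intuition.
Qed.

(** The sum of the negated characteristic values, [c i v] below, counts the counterexamples under
    the bound, so it vanishes exactly when there are none. *)
Lemma primrec_pred_forall n (P : nat -> n.-tuple nat -> Prop)
    (m : n.-tuple nat -> nat) :
  primrec m ->
  primrec_pred (fun w : n.+1.-tuple nat => P (nth 0 w 0) [tuple of behead w]) ->
  primrec_pred (fun v => forall i, i < m v -> P i v).
Proof.
move=> m_pr [b b_pr Pb].
pose c i (v : n.-tuple nat) : nat := 1 - b [tuple of i :: v].
apply: (@primrec_pred_ext _ (fun v => \sum_(i < m v) c i v = 0)).
  move=> v; have Pc i : P i v <-> c i v = 0.
    have := Pb [tuple of i :: v]; rewrite /= (_ : [tuple of _] = v).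
      by rewrite /c => ->; case: (b _).
    exact: val_inj.
  split=> [/eqP | Pv]; last by apply: big1 => i _; apply/Pc/Pv.
  rewrite sum_nat_eq0 => /forallP c0 i lt_im.
  by apply/Pc/eqP; have := c0 (Ordinal lt_im).
apply/primrec_pred_eq0/primrec_sum => //.
apply: primrec_comp2 subn_primrec (primrec_const _ 1) _.
apply: primrec_ext b_pr => w; congr (nat_of_bool (b _)).
by apply: val_inj; case/tupleP: w.
Qed.

Lemma primrec_pred_exists n (P : nat -> n.-tuple nat -> Prop)
    (m : n.-tuple nat -> nat) :
  primrec m ->
  primrec_pred (fun w : n.+1.-tuple nat => P (nth 0 w 0) [tuple of behead w]) ->
  primrec_pred (fun v => exists2 i, i < m v & P i v).
Proof.
move=> m_pr P_pr.
apply: primrec_pred_ext (primrec_predN (primrec_pred_forall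
  (P := fun i v => ~ P i v) m_pr (primrec_predN P_pr))) => v.
case: P_pr => b _ Pb.
have Pbv i : P i v <-> b [tuple of i :: v].
  by rewrite -Pb /= (_ : [tuple of _] = v) //; apply: val_inj.
split=> [notPv | [i lt_im Piv] /(_ i lt_im) //].
(* A boolean search through the finitely many [i] below the bound turns the doubly negated statement
   into an actual witness. *)
have [/existsP[i bi] | /existsPn bF] :=
  boolP [exists i : 'I_(m v), b [tuple of (i : nat) :: v]].
  by exists i => //; apply/Pbv.
case: notPv => i lt_im /Pbv; exact/negP/(bF (Ordinal lt_im)).
Qed.

(** * Binary expansions *)

Lemma odd_primrec : primrec_fun1 (fun a => odd a).
Proof.
apply: primrec_ext (@primrec_nat_rect 1 _ _ (fun _ r _ => 1 - r)
  (primrec_const _ 0) (primrec_nth _ 0) _).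
  by move=> v; elim: (nth 0 v 0) => //= k ->; case: odd.
exact: primrec_comp2 subn_primrec (primrec_const _ 1) (primrec_nth _ 1).
Qed.

(** The condition says [i < a %/ d], and [a %/ d <= a], so the sum counts all such [i]. This makes
    division, and with it [bit], a bounded sum. *)
Lemma divn_sum a d : 0 < d -> a %/ d = \sum_(i < a) (i.+1 * d <= a).
Proof.
move=> d_gt0; have sum_lt k n : \sum_(i < n) (i < k) = minn n k.
  by elim: n => [|n IHn]; rewrite ?big_ord0 ?big_ord_recr /= ?IHn; lia.
under eq_bigr => i _ do rewrite -leq_divRL //.
by rewrite sum_lt; apply/esym/minn_idPr/leq_div.
Qed.

Lemma bit_primrec : primrec_fun2 bit.
Proof.
have leq_primrec : primrec_fun2 (fun a b => a <= b).
  apply: primrec_ext (primrec_comp2 subn_primrec (primrec_const _ 1)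
    subn_primrec) => v /=.
  by rewrite /leq; case: (nth 0 v 0 - nth 0 v 1).
apply: primrec_comp1 odd_primrec _.
apply: primrec_ext (@primrec_sum _
  (fun i v => i.+1 * 2 ^ nth 0 v 1 <= nth 0 v 0) _ (primrec_nth _ 0) _) => [v|].
  by rewrite divn_sum ?expn_gt0.
apply: primrec_comp2 leq_primrec _ (primrec_nth_behead _ _).
apply: primrec_comp2 muln_primrec _ _.
  exact: primrec_comp1 succn_primrec (primrec_nth _ _).
exact: primrec_comp2 expn_primrec (primrec_const _ _) (primrec_nth_behead _ _).
Qed.

(** The common shape of [even_CL], [odd_CL] and both halves of [pair_CL]: [d] selects the bit that
    is read and [e] the place where it is written. *)
Lemma primrec_bit_sum m n (d e : nat -> nat) :
  primrec_fun1 d -> primrec_fun1 e ->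
  primrec (fun v : n.-tuple nat =>
    \sum_(i < nth 0 v m) bit (nth 0 v m) (d i) * 2 ^ e i).
Proof.
move=> d_pr e_pr.
apply: (@primrec_sum _ (fun i v => bit (nth 0 v m) (d i) * 2 ^ e i)).
  exact: primrec_nth.
apply: primrec_comp2 muln_primrec _ _.
  apply: primrec_comp2 bit_primrec (primrec_nth_behead _ _) _.
  exact: primrec_comp1 d_pr (primrec_nth _ _).
apply: primrec_comp2 expn_primrec (primrec_const _ _) _.
exact: primrec_comp1 e_pr (primrec_nth _ _).
Qed.

Lemma double_primrec : primrec_fun1 (fun i => 2 * i).
Proof.
exact: primrec_comp2 muln_primrec (primrec_const _ _) (primrec_nth _ _).
Qed.

Lemma doubleD1_primrec : primrec_fun1 (fun i => 2 * i + 1).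
Proof.
exact: primrec_comp2 addn_primrec double_primrec (primrec_const _ _).
Qed.

Lemma even_CL_primrec : primrec_fun1 even_CL.
Proof.
exact: (@primrec_bit_sum 0 1 _ id) double_primrec (primrec_nth 1 0).
Qed.

Lemma odd_CL_primrec : primrec_fun1 odd_CL.
Proof.
exact: (@primrec_bit_sum 0 1 _ id) doubleD1_primrec (primrec_nth 1 0).
Qed.

Lemma pair_CL_primrec : primrec_fun2 pair_CL.
Proof.
apply: primrec_comp2 addn_primrec _ _.
  exact: (@primrec_bit_sum 0 2 id) (primrec_nth 1 0) double_primrec.
exact: (@primrec_bit_sum 1 2 id) (primrec_nth 1 0) doubleD1_primrec.
Qed.

Lemma bit_sum a : \sum_(i < a) bit a i * 2 ^ i = a.
Proof.
(* The first [n] bits give the residue modulo [2 ^ n]; for [n = a] this is [a] itself, since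
   [a < 2 ^ a]. *)
suff modE n : \sum_(i < n) bit a i * 2 ^ i = a %% 2 ^ n.
  by rewrite modE modn_small // ltn_expl.
elim: n => [|n IHn]; first by rewrite big_ord0 modn1.
rewrite big_ord_recr /= IHn /bit expnS.
set d := 2 ^ n; have d_gt0 : 0 < d by rewrite expn_gt0.
(* Splitting the quotient into twice its half plus its parity exhibits the residue modulo [2 * d]:
   the old residue plus the new bit times [d]. *)
have eq_a : a = (a %/ d)./2 * (2 * d) + (a %% d + odd (a %/ d) * d).
  by rewrite {1}(divn_eq a d) -{1}(odd_double_half (a %/ d)) -muln2; lia.
rewrite [in RHS]eq_a modnMDl [in RHS]modn_small //.
by have := ltn_pmod a d_gt0; case: odd; lia.
Qed.

(** Termwise comparison with the binary expansion of [a], using [i <= 2 * i]. With its companion for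
    [b], it bounds the search for the components of a line. *)
Lemma leq_pair_CLl a b : a <= pair_CL a b.
Proof.
apply: leq_trans (leq_addr _ _); rewrite -{1}[a]bit_sum.
by apply: leq_sum => i _; rewrite leq_mul2l leq_pexp2l //; lia.
Qed.

Lemma leq_pair_CLr a b : b <= pair_CL a b.
Proof.
apply: leq_trans (leq_addl _ _); rewrite -{1}[b]bit_sum.
by apply: leq_sum => i _; rewrite leq_mul2l leq_pexp2l //; lia.
Qed.

Lemma Pair_primrec : primrec_pred3 Pair.
Proof.
apply: primrec_predI; apply: primrec_pred_eq (primrec_nth _ _).
  exact: primrec_comp1 even_CL_primrec (primrec_nth _ _).
exact: primrec_comp1 odd_CL_primrec (primrec_nth _ _).
Qed.

(** * Formula codes and axiom heads *)

(** Trades the quantifiers over formulas for equations between codes. The implication test stays as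
    a conjunct because [ante] and [csq] are specified only on codes of implications. *)
Lemma imp_codeP (F : formula_coding) (ante csq : nat -> nat) n a b :
  (forall A B : formula F, ante (fcode (imp A B)) = fcode A) ->
  (forall A B : formula F, csq (fcode (imp A B)) = fcode B) ->
  (exists A B : formula F, [/\ n = fcode (imp A B), a = fcode A & b = fcode B])
  <-> (exists A B : formula F, n = fcode (imp A B)) /\ ante n = a /\ csq n = b.
Proof.
move=> anteE csqE; split=> [[A [B [-> -> ->]]] | [[A [B ->]] [<- <-]]].
  by rewrite anteE csqE; split=> //; exists A, B.
by exists A, B; rewrite anteE csqE.
Qed.

Lemma axiom_head_primrec (F : formula_coding) : primrec_pred1 (axiom_head F).
Proof.
have [ante ante_pr anteE] := antecedent_primrec F.
have [csq csq_pr csqE] := consequent_primrec F.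
pose is_imp n := exists A B : formula F, n = fcode (imp A B).
have is_imp_pr : primrec_pred1 is_imp := is_imp_primrec F.
pose K n := is_imp n /\ is_imp (csq n) /\ csq (csq n) = ante n.
(* The six tests give [n] the shape [(A -> (B -> C)) -> ((A1 -> B1) -> (A2 -> C1))]; the four
   equations then identify [A1] with [A], [B1] with [B], [A2] with [A] and [C1] with [C]. *)
pose S n := is_imp n /\ is_imp (ante n) /\ is_imp (csq (ante n)) /\
  is_imp (csq n) /\ is_imp (ante (csq n)) /\ is_imp (csq (csq n)) /\
  ante (ante (csq n)) = ante (ante n) /\
  csq (ante (csq n)) = ante (csq (ante n)) /\
  ante (csq (csq n)) = ante (ante n) /\
  csq (csq (csq n)) = csq (csq (ante n)).
apply: (@primrec_pred_ext _ (fun v => K (nth 0 v 0) \/ S (nth 0 v 0))) => [v|].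
  move: (nth 0 v 0) => n; pose codeE := (anteE, csqE).
  split=> [[[[A [X ->]]] | [[P [Q ->]]]] | [[A [B ->]] | [A [B [C ->]]]]].
  - rewrite !codeE => -[[B [A' /fcode_inj->]]]; rewrite !codeE => /fcode_inj->.
    by left; exists A, B.
  (* Once the extractions are evaluated, each implication test equates two formula codes;
     injectivity lifts this to formulas and exposes one more connective. *)
  - rewrite !codeE => -[[A [X /fcode_inj->]]].
    rewrite !codeE => -[[B [C /fcode_inj->]]].
    rewrite !codeE => -[[Y [Z /fcode_inj->]]].
    rewrite !codeE => -[[A1 [B1 /fcode_inj->]]].
    rewrite !codeE => -[[A2 [C1 /fcode_inj->]]].
    rewrite !codeE
      => -[/fcode_inj-> [/fcode_inj-> [/fcode_inj-> /fcode_inj->]]].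
    by right; exists A, B, C.
  - left; rewrite /K /schema_K !codeE.
    by split; [exists A, (imp B A) | split=> //; exists B, A].
  right; rewrite /S /schema_S !codeE.
  do !split=> //; do 2!eexists; reflexivity.
have v0 := primrec_nth 1 0.
have anteP f := primrec_comp1 (n := 1) (a := f) ante_pr.
have csqP f := primrec_comp1 (n := 1) (a := f) csq_pr.
have impP f := primrec_pred_comp1 (n := 1) (f := f) is_imp_pr.
by apply: primrec_predU; do ![apply: primrec_predI];
  do ![apply (impP _) | apply: primrec_pred_eq | apply (anteP _)
    | apply (csqP _)].
Qed.

(** * Line codes and Modus Ponens alignment *)

Lemma line_code_primrec (F : formula_coding) (T : tag_coding) :
  primrec_pred1 (line_code F T).
Proof.
pose Q t phi l :=
  is_tag T t /\ (exists A : formula F, phi = fcode A) /\ l = pair_CL t phi.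
apply: (@primrec_pred_ext _ (fun v => exists2 t, t < (nth 0 v 0).+1 &
    exists2 phi, phi < (nth 0 v 0).+1 & Q t phi (nth 0 v 0))) => [v|].
  split=> [[t _ [_ _ [tagt [[A ->] lE]]]] | [t [A [tagt lE]]]];
    first by exists t, A.
  exists t; first by rewrite lE ltnS leq_pair_CLl.
  exists (fcode A); first by rewrite lE ltnS leq_pair_CLr.
  by split=> //; split=> //; exists A.
have succP n a := primrec_comp1 (n := n) (a := a) succn_primrec.
apply: (@primrec_pred_exists _ (fun t v =>
  exists2 phi, phi < (nth 0 v 0).+1 & Q t phi (nth 0 v 0))).
  exact: succP (primrec_nth _ _).
apply: (@primrec_pred_exists _ (fun phi w =>
  Q (nth 0 w 0) phi (nth 0 (behead w) 0))).
  exact: succP (primrec_nth_behead _ _).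
(* Under both quantifiers the tuple holds the formula code, the tag and the line, in this order. *)
have tag_pr : primrec (fun w : 3.-tuple nat => nth 0 (behead w) 0).
  exact: primrec_nth_behead.
apply: primrec_predI; first exact: primrec_pred_comp1 (is_tag_primrec T) tag_pr.
apply: primrec_predI.
  exact: primrec_pred_comp1 (fcode_primrec F) (primrec_nth _ _).
apply: primrec_pred_eq; first exact: primrec_nth_behead2.
exact: primrec_comp2 pair_CL_primrec tag_pr (primrec_nth _ _).
Qed.

(* [MP_aligned F T s] is [MP_at F T (nth 0 s)]; abstracting from the sequence
   allows its lines to be read off its code. *)
Definition MP_at (F : formula_coding) (T : tag_coding) (l : nat -> nat)
    (j : nat) : Prop :=
  let t := line_tag (l j) in
  let p := cited_p T t in
  let q := cited_q T t in
  [/\ is_MP_tag T t, p < j, q < j &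
      exists A B : formula F,
        [/\ line_formula (l q) = fcode (imp A B),
            line_formula (l p) = fcode A &
            line_formula (l j) = fcode B]].

(** Alignment at [j] reads line [j] and two cited lines before it. Agreement up to [j] suffices,
    which matters because decoding is specified only at indices below the size. *)
Lemma eq_MP_at (F : formula_coding) (T : tag_coding) (k l : nat -> nat) j :
  (forall i, i <= j -> k i = l i) -> MP_at F T k j <-> MP_at F T l j.
Proof.
suff imp_at h h' : (forall i, i <= j -> h i = h' i) ->
    MP_at F T h j -> MP_at F T h' j.
  by move=> eq_kl; split; apply: imp_at => i /eq_kl.
by move=> eq_h; rewrite /MP_at eq_h // => -[tagt pj qj]; rewrite !eq_h // ltnW.
Qed.

Lemma MP_at_primrec (F : formula_coding) (T : tag_coding)
    (line : nat -> nat -> nat) :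
  primrec_fun2 line -> primrec_pred2 (fun D j => MP_at F T (line D) j).
Proof.
move=> line_pr.
have [ante ante_pr anteE] := antecedent_primrec F.
have [csq csq_pr csqE] := consequent_primrec F.
pose is_imp n := exists A B : formula F, n = fcode (imp A B).
have is_imp_pr : primrec_pred1 is_imp := is_imp_primrec F.
pose tag D j := line_tag (line D j).
pose phi D j := line_formula (line D j).
pose p D j := cited_p T (tag D j).
pose q D j := cited_q T (tag D j).
apply: (@primrec_pred_ext 2 (fun v =>
  let D := nth 0 v 0 in let j := nth 0 v 1 in
    is_MP_tag T (tag D j) /\ p D j < j /\ q D j < j /\
    is_imp (phi D (q D j)) /\
    ante (phi D (q D j)) = phi D (p D j) /\ csq (phi D (q D j)) = phi D j)).
  move=> v; rewrite /MP_at; split=> [[tagt [pj [qj]]] | [tagt pj qj]].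
    by move/(imp_codeP _ _ _ anteE csqE).
  by move/(imp_codeP _ _ _ anteE csqE).
have D_pr := primrec_nth 2 0; have j_pr := primrec_nth 2 1.
have tag_pr := primrec_comp1 even_CL_primrec (primrec_comp2 line_pr D_pr j_pr).
have phi_pr f : primrec f ->
  primrec (fun v : 2.-tuple nat => phi (nth 0 v 0) (f v)).
  move=> f_pr.
  exact: primrec_comp1 odd_CL_primrec (primrec_comp2 line_pr D_pr f_pr).
have p_pr := primrec_comp1 (cited_p_primrec T) tag_pr.
have q_pr := primrec_comp1 (cited_q_primrec T) tag_pr.
apply: primrec_predI;
  first exact: primrec_pred_comp1 (is_MP_tag_primrec T) tag_pr.
do 2![apply: primrec_predI; first exact: primrec_pred_lt].
apply: primrec_predI.
  exact: primrec_pred_comp1 is_imp_pr (phi_pr _ q_pr).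
apply: primrec_predI; apply: primrec_pred_eq; try exact: (phi_pr).
  exact: primrec_comp1 ante_pr (phi_pr _ q_pr).
exact: primrec_comp1 csq_pr (phi_pr _ q_pr).
Qed.

(** * Predicates on derivation codes *)

Theorem proposition4p1p1 (F : formula_coding) (S : seq_coding)
    (T : tag_coding) :
  [/\ primrec_pred3 Pair,
      primrec_pred1 (axiom_head F),
      primrec_pred2 (MP_accepted F S T) &
      primrec_pred2 (witness F S T)].
Proof.
have [len len_pr lenE] := size_primrec S.
have [line line_pr lineE] := nth_primrec S.
pose is_seq D := exists s, D = scode S s.
(* Membership in the sequence becomes a bounded quantifier over indices, stated on the code
   alone. *)
pose deriv D := forall j, j < len D -> line_code F T (line D j).
have D_pr n i := primrec_comp1 len_pr (primrec_nth n i).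
have is_seq_pr : primrec_pred1 is_seq := scode_primrec S.
have derivE s : deriv (scode S s) <-> derivation F T s.
  rewrite /deriv lenE; split=> [line_s l /(nthP 0)[j lt_js <-] | der_s j lt_js].
    by rewrite -lineE //; apply: line_s.
  by rewrite lineE //; apply/der_s/mem_nth.
have MP_E s j : j < size s ->
    MP_at F T (line (scode S s)) j <-> MP_aligned F T s j.
  by move=> lt_js; apply: eq_MP_at => i le_ij;
    apply/lineE/(leq_ltn_trans le_ij).
have deriv_pr : primrec_pred1 deriv.
  apply: (@primrec_pred_forall 1
    (fun j v => line_code F T (line (nth 0 v 0) j))); first exact: D_pr.
  apply: primrec_pred_comp1 (line_code_primrec F T) _.
  exact: primrec_comp2 line_pr (primrec_nth_behead _ _) (primrec_nth _ _).
have MP_pr := MP_at_primrec F T line_pr.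
split; [exact: Pair_primrec | exact: axiom_head_primrec | |].
  (* The sequence is eliminated: [is_seq D] ensures that [len] and [line] really compute its size
     and, below that size, its entries. *)
  apply: (@primrec_pred_ext 2 (fun v => let j := nth 0 v 0 in
    let D := nth 0 v 1 in
    is_seq D /\ deriv D /\ j < len D /\ MP_at F T (line D) j)) => [v|].
    move: (nth 0 v 0) (nth 0 v 1) => j D.
    split=> [[[s ->] [/derivE der_s]] | [s [-> der_s lt_js al]]].
      by rewrite lenE => -[lt_js /(MP_E _ _ lt_js) al]; exists s.
    by split; [exists s | rewrite lenE derivE MP_E].
  apply: primrec_predI;
    first exact: primrec_pred_comp1 is_seq_pr (primrec_nth _ _).
  apply: primrec_predI;
    first exact: primrec_pred_comp1 deriv_pr (primrec_nth _ _).
  apply: primrec_predI;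
    first exact: primrec_pred_lt (primrec_nth _ _) (D_pr _ _).
  exact: primrec_pred_comp2 MP_pr (primrec_nth _ _) (primrec_nth _ _).
pose acc D j := axiom_head F (line_formula (line D j)) \/ MP_at F T (line D) j.
(* The last line is read at index [(len D).-1], which is in range because [0 < len D]. *)
apply: (@primrec_pred_ext 2 (fun v => let phi := nth 0 v 0 in
  let D := nth 0 v 1 in
  is_seq D /\ deriv D /\ 0 < len D /\ line_formula (line D (len D).-1) = phi /\
  (forall j, j < len D -> acc D j))) => [v|].
  move: (nth 0 v 0) (nth 0 v 1) => phi D.
  have accE s j : j < size s -> acc (scode S s) j <->
      axiom_head F (line_formula (nth 0 s j)) \/ MP_aligned F T s j.
    by move=> lt_js; rewrite /acc MP_E // lineE.
  split=> [[[s ->] [/derivE der_s]] | [s [-> der_s s_gt0 phiE acc_s]]].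
    rewrite lenE => -[s_gt0]; rewrite lineE ?ltn_predL //
      nth_last => -[phiE acc_s].
    by exists s; split=> // j lt_js; apply/accE/acc_s.
  split; first by exists s.
  rewrite derivE lenE lineE ?ltn_predL // nth_last; do !split=> //.
  by move=> j lt_js; apply/accE/acc_s.
apply: primrec_predI;
  first exact: primrec_pred_comp1 is_seq_pr (primrec_nth _ _).
apply: primrec_predI;
  first exact: primrec_pred_comp1 deriv_pr (primrec_nth _ _).
apply: primrec_predI;
  first exact: primrec_pred_lt (primrec_const _ _) (D_pr _ _).
apply: primrec_predI.
  apply: primrec_pred_eq (primrec_nth _ _).
  apply: primrec_comp1 odd_CL_primrec _.
  apply: primrec_comp2 line_pr (primrec_nth _ _) _.
  exact: primrec_comp1 predn_primrec (D_pr _ _).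
apply: (@primrec_pred_forall 2 (fun j v => acc (nth 0 v 1) j));
  first exact: D_pr.
apply: primrec_predU.
  apply: primrec_pred_comp1 (axiom_head_primrec F) _.
  apply: primrec_comp1 odd_CL_primrec _.
  exact: primrec_comp2 line_pr (primrec_nth_behead _ _) (primrec_nth _ _).
exact: primrec_pred_comp2 MP_pr (primrec_nth_behead _ _) (primrec_nth _ _).
Qed.
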